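(* A sequence of integers $(a_1,a_2,a_3;b_1,b_2,b_3;s)$ with $a_1\le a_2\le a_3$ and $b_1\ge b_2\ge b_3$ is an essential Betti sequence if and only if 1) $s=\sum_{j=1}^3 b_j-\sum_{i=1}^3 a_i$; 2) $\sum_{i=1}^3 a_i<b_2+b_3$; 3) $a_j+b_j\le\sum_{i=1}^3 a_i$ for $1\le j\le 3$.
   Context: $k$ is a field. A sequence $(a_1,\ldots,a_n;b_1,\ldots,b_n;s)$ is called an essential Betti sequence if there is a homogeneous ideal $I$ of height at least $2$ in a standard graded polynomial ring $R=k[x_1,\ldots,x_r]$ for some $r\ge 3$ (the number of variables is not prescribed) such that $R/I$ has a graded minimal free resolution $$0\to R(-s)\to\bigoplus_{j=1}^n R(-b_j)\to\bigoplus_{i=1}^n R(-a_i)\to R\to R/I\to 0.$$ *)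

(* Defs.v *)
From mathcomp Require Import all_boot all_order all_algebra.
From mathcomp Require Import ring_quotient.
From mathcomp Require Import mpoly.

Set Implicit Arguments.
Unset Strict Implicit.
Unset Printing Implicit Defensive.

Import GRing.Theory Num.Theory.

Local Open Scope ring_scope.

Section Height.
Variable R : comNzRingType.
Implicit Types (P : prime_idealr R) (I : idealr R).

(* There is a chain C_0 < C_1 < ... < C_h = P of primes, that is ht P >= h. *)
Definition prime_height_ge P (h : nat) : Prop :=
  exists C : nat -> prime_idealr R,
    (forall i, (i < h)%N ->
       {subset C i <= C i.+1} /\ exists2 x, x \in C i.+1 & x \notin C i)
    /\ C h =i P.

(* The height of an ideal is the infimum of the heights of the primes above
   it. *)
Definition height_ge I (h : nat) : Prop :=
  forall P, {subset I <= P} -> prime_height_ge P h.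

End Height.

Section GradedResolution.
Variables (k : fieldType) (r : nat).
Local Notation S := {mpoly k[r]}.

Definition homogeneous_ideal (I : idealr S) : Prop :=
  forall p, p \in I -> forall d, pihomog mdeg d p \in I.

(* There are no nonzero forms of negative degree. *)
Definition homog_of_degree (d : int) (p : S) : Prop :=
  match d with
  | Posz e => p \is e.-homog
  | Negz _ => p = 0
  end.

(* Free modules consist of row vectors and a map acts by u |-> u *m A.  The
   matrix A is homogeneous of degree 0 as a map from the direct sum of the
   S(- d i) to the direct sum of the S(- e j). *)
Definition graded_map m n (d : 'I_m -> int) (e : 'I_n -> int) (A : 'M[S]_(m, n))
  : Prop := forall i j, homog_of_degree (d i - e j) (A i j).

(* The image lies in (x_1, ..., x_r) times the target: the entries have zero
   constant term. *)
Definition minimal_map m n (A : 'M[S]_(m, n)) : Prop :=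
  forall i j, (A i j)@_0%MM = 0.

Definition exact_at l m n (A : 'M[S]_(l, m)) (B : 'M[S]_(m, n)) : Prop :=
  forall u : 'rV[S]_m, u *m B = 0 <-> exists v : 'rV[S]_l, u = v *m A.

(* S/I has a graded minimal free resolution
     0 -> S(-s) -> (+)_j S(-b_j) -> (+)_i S(-a_i) -> S -> S/I -> 0
   with differentials d3, d2, d1 and the canonical projection S -> S/I. *)
Definition has_minimal_resolution (I : idealr S) n (a b : 'I_n -> int) (s : int)
  : Prop :=
  exists (d1 : 'M[S]_(n, 1)) (d2 : 'M[S]_(n, n)) (d3 : 'M[S]_(1, n)),
    [/\ [/\ graded_map a (fun=> 0) d1, graded_map b a d2
          & graded_map (fun=> s) b d3],
        [/\ minimal_map d1, minimal_map d2 & minimal_map d3]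
      & [/\ forall p, p \in I <-> exists u : 'rV[S]_n, p%:M = u *m d1,
            exact_at d2 d1,
            exact_at d3 d2
          & forall u : 'rV[S]_1, u *m d3 = 0 -> u = 0]].

End GradedResolution.

Definition essential_betti (k : fieldType) n (a b : n.-tuple int) (s : int)
  : Prop :=
  exists (r : nat) (I : idealr {mpoly k[r]}),
    [/\ (3 <= r)%N, homogeneous_ideal I, height_ge I 2
      & has_minimal_resolution I (tnth a) (tnth b) s].

(* Main.v *)
Require Import Defs.
From HB Require Import structures.
From mathcomp Require Import all_boot all_order all_algebra.
From mathcomp Require Import ring_quotient perm mpoly.
From mathcomp Require Import zify ring.
From Stdlib Require Import Classical.
Set Implicit Arguments.
Unset Strict Implicit.
Unset Printing Implicit Defensive.
Import Order.TTheory GRing.Theory Num.Theory.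
Import Pdiv.Idomain.
Local Open Scope ring_scope.

(** Write f, D and y for the three differentials: f is the column of
    generators of I, D is a 3 x 3 matrix and y is a row with three entries.
    Indices start from 1 in this overview and from 0 in the lemmas.

    Necessity.  Height at least 2 enters only in one form: if g has no
    constant term, then the generators f_i are not all multiples of g
    ([height2_nonunit]).  Indeed g lies in a prime P of height at most 1: move
    a variable occurring in g to the last place, so that the ring becomes A[X]
    with A a domain, choose h irreducible over the fraction field of A dividing
    g there, and let P consist of the multiples of h over that field.

    Exactness alone gives that D has rank two and more: it persists modulo any
    element th ([exact_yD_mod]), hence an element e which multiplies all the 2 x 2
    minors of D into (th) lies in (th) ([divides_minors]).  The cross product
    of two columns of D is orthogonal to D, hence a multiple t_i y of y; the
    vectors t and f are both orthogonal to the rows of D, hence proportional,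
    and the previous remark yields f = g t ([rank_two_factorization]).  By the
    height hypothesis g has a nonzero constant term, so comparing the degrees of
    f_i y_j and of the minor t_i y_j gives s = sum b - sum a ([degree_sum]).

    If y_1 = 0 the same kind of argument shows that y_2 and y_3 generate the
    unit ideal, which minimality forbids.  So y_1 is a nonzero form without
    constant term and s > b_1, which is the second condition.

    The third condition comes from the Koszul relations f_i e_j - f_j e_i, of
    degree a_i + a_j.  They are combinations of the rows of D with homogeneous
    coefficients ([koszul_lift]), so a row of D of too large a degree b_l is not
    used.  If b_3 > a_1 + a_2, then f_1 e_2 - f_2 e_1 = 0 and I is principal.  If
    b_2 > a_1 + a_3, then two of the relations are multiples of the last row of
    D, which makes I a subideal of an ideal generated by one entry of D.  If
    b_1 > a_2 + a_3, then the first row of D occurs in no Koszul relation,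
    although each f_i times it is a combination of them; so f_i is a multiple
    of y_1.

    Sufficiency.  Put p_i = s - b_i > 0 and c_i = a_1 + a_2 + a_3 - a_i - b_i,
    which is nonnegative.  With indices modulo 3, take the regular sequence
    y_i = x_i^p_i, let m_i = x_(i+1)^c_i, and let D be the Koszul matrix of y
    with its i-th column multiplied by m_i.  The generators are then the
    monomials f_i = m_(i+1) m_(i+2) y_i.  Every prime containing them contains
    two of the three variables, whence height 2, and exactness reduces to that
    of the Koszul complex of y because m_i is coprime to m_(i+1) m_(i+2) y_i. *)

(** * Ideals of height at least two *)

Definition divides (R : comNzRingType) (x y : R) := exists z, y = x * z.

Lemma idealr_of_closed (R : comNzRingType) (P : {pred R}) :
  idealr_closed P -> exists C : idealr R, C =i P.
Proof.
move=> Pid.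
by exists (HB.pack_for (idealr R) (P : R -> bool) (isIdealr.Build R P Pid)).
Qed.

Lemma prime_idealr_of_closed (R : comNzRingType) (P : {pred R}) :
  idealr_closed P -> prime_idealr_closed P -> exists C : prime_idealr R, C =i P.
Proof.
move=> Pid Ppr.
by exists (HB.pack_for (prime_idealr R) (P : R -> bool)
  (isIdealr.Build R P Pid) (isPrimeIdealrClosed.Build R P Ppr)).
Qed.

Section Irreducible.
Variable A : idomainType.
Implicit Types p q f : {poly A}.

(** Divisibility and irreducibility of polynomials over the domain A are those
    over its fraction field. *)
Lemma irreducible_factor p :
  (1 < size p)%N -> exists2 f, irreducible_poly f & f %| p.
Proof.
have [n] := ubnP (size p); elim: n p => // n IH p; rewrite ltnS => lepn p1.
have p0 : p != 0 by rewrite -size_poly_gt0 ltnW.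
have [irrp|] := classic (irreducible_poly p); first by exists p.
move=> nirr; have [q] : exists q, [/\ size q != 1, q %| p & ~~ (q %= p)].
  apply: NNPP => nq; apply: nirr; split=> // q q1 qp; apply/negPn/negP => nqp.
  by apply: nq; exists q.
case=> q1 qp; rewrite -(dvdp_size_eqp qp) => sq.
have q0 : q != 0 by apply: contraTneq qp => ->; rewrite dvd0p.
have ltqp : (size q < size p)%N by rewrite ltn_neqAle sq dvdp_leq.
have [||f irrf fq] := IH q; first exact: leq_trans ltqp lepn.
  by rewrite ltn_neqAle eq_sym q1 size_poly_gt0.
by exists f => //; apply: dvdp_trans fq qp.
Qed.

Lemma irreducible_prime f p q :
  irreducible_poly f -> f %| p * q -> (f %| p) || (f %| q).
Proof.
move=> irrf fpq; have [//|nfp] := boolP (f %| p).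
suff co : coprimep f p by rewrite -(Gauss_dvdpr q co).
apply/coprimepP => d df dp; apply/negPn/negP => nd1.
case/negP: nfp; apply: dvdp_trans dp; have := irrf.2 d.
by rewrite size_poly_eq1 => /(_ nd1 df) /andP[].
Qed.

(** The descent step: the denominators c are constants, so that cancelling f
    lowers the degree. *)
Lemma dvdp_cofactor f p : f %| p -> p != 0 -> (1 < size f)%N ->
  exists c q, [/\ c != 0, c%:P * p = q * f, q != 0 & (size q < size p)%N].
Proof.
move=> /dvdpP [[c q] /= c0 e] p0 f1; exists c, q; rewrite mul_polyC.
have f0 : f != 0 by rewrite -size_poly_gt0 ltnW.
have q0 : q != 0.
  apply: contraNneq p0 => q0; move/eqP: e; rewrite q0 mul0r.
  by rewrite -mul_polyC mulf_eq0 polyC_eq0 (negPf c0).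
split=> //; rewrite -(size_scale p c0) e size_mul //.
by rewrite (polySpred f0) addnS /= -[X in (X < _)%N]addn0 ltn_add2l; lia.
Qed.

End Irreducible.

Section Contraction.
Variables (S : idomainType) (A : idomainType).
Variable phi : {rmorphism S -> {poly A}}.
Hypotheses (phi_inj : injective phi) (phi_surj : forall p, exists x, phi x = p).
Variable f : {poly A}.
Hypothesis irrf : irreducible_poly f.

(** When [phi] is an isomorphism, this is the contraction to S of the prime
    generated by f in the polynomial ring over the fraction field of A. *)
Lemma contraction_prime : exists P : prime_idealr S, P =i [pred x | f %| phi x].
Proof.
apply: prime_idealr_of_closed.
  split=> [||a u v]; rewrite !inE ?rmorph0 ?rmorph1 ?dvdp0 //.
    by rewrite dvdp1 gtn_eqF ?irrf.1.
  by move=> fu fv; rewrite rmorphD rmorphM dvdp_add // dvdp_mull.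
by move=> u v; rewrite !inE rmorphM; apply: irreducible_prime.
Qed.

(** A prime C_1 strictly above a prime C_0 and inside P has a nonzero element.
    Dividing it by f repeatedly shows that f itself is in C_1, since C_1 is prime and the
    quotients have smaller degree.  Any element of P becomes a multiple of f
    once multiplied by a nonzero constant, and such constants are outside P;
    therefore C_1 is all of P. *)
Lemma contraction_height_le1 (P : prime_idealr S) :
  P =i [pred x | f %| phi x] -> ~ prime_height_ge P 2.
Proof.
move=> defP [C [C_lt CP]].
have [_ [x xC1 xC0]] := C_lt 0%N isT; have [C12 [h hC2 hC1]] := C_lt 1%N isT.
have inP z : z \in C 1%N -> f %| phi z.
  by move=> /C12; rewrite CP defP.
have x0 : x != 0 by apply: contraNneq xC0 => ->; apply: idealr0.
have [F phiF] := phi_surj f.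
have FC1 z : z \in C 1%N -> z != 0 -> F \in C 1%N.
  have [n] := ubnP (size (phi z)); elim: n z => // n IH z; rewrite ltnS => lezn zC z0.
  have pz0 : phi z != 0 by rewrite -(rmorph0 phi) (inj_eq phi_inj).
  have [c [q [c0 e q0 ltq]]] := dvdp_cofactor (inP z zC) pz0 irrf.1.
  have [c' ec] := phi_surj c%:P; have [q' eq'] := phi_surj q.
  have : q' * F \in C 1%N.
    suff <- : c' * z = q' * F by apply: idealMr.
    by apply: phi_inj; rewrite !rmorphM ec eq' phiF.
  rewrite prime_idealrM => /orP[q'C|//]; apply: IH q'C _.
    by rewrite eq'; apply: leq_trans ltq lezn.
  by apply: contraNneq q0 => q'0; rewrite -eq' q'0 rmorph0.
have {}FC1 : F \in C 1%N by apply: FC1 xC1 x0.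
have : f %| phi h by move: hC2; rewrite CP defP.
case/dvdpP => -[c q] /= c0 e.
have [c' ec] := phi_surj c%:P; have [q' eq'] := phi_surj q.
have : c' * h \in C 1%N.
  suff -> : c' * h = q' * F by apply: idealMr.
  by apply: phi_inj; rewrite !rmorphM ec eq' phiF mul_polyC.
rewrite prime_idealrM (negPf hC1) orbF => /inP; rewrite ec => /dvdp_leq.
by rewrite polyC_eq0 size_polyC c0 => /(_ isT); rewrite leqNgt irrf.1.
Qed.

End Contraction.

Section LastVariable.
Variables (k : fieldType) (n : nat).
Local Notation S := {mpoly k[n.+1]}.
Local Notation lower m := [multinom (m : 'X_{1..n.+1}) (widen_ord (leqnSn n) i) | i < n].

(** Reading off a coefficient; this gives both the injectivity of [muni] and a
    lower bound for its degree. *)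
Lemma mcoeff_muni (p : S) (m : 'X_{1..n.+1}) :
  (muni p)`_(m ord_max)@_(lower m) = p@_m.
Proof.
rewrite muniE coef_sum raddf_sum /= [in RHS](mpolyE p) raddf_sum /=.
apply: eq_bigr => m' _; rewrite coefZ coefXn mcoeffZ mcoeffX.
rewrite mulr_natr mcoeffMn mcoeffZ mcoeffX -mulrnAr -mulrnA mulnb.
congr (_ * _%:R).
congr nat_of_bool; apply/andP/eqP => [[/eqP lowE /eqP maxE]|-> //].
apply/mnmP => i; have [j ->|->] := unliftP ord_max i; last by [].
move/mnmP/(_ j): lowE; rewrite !mnmE.
suff -> : widen_ord (leqnSn n) j = lift ord_max j by [].
by apply: val_inj; rewrite /= /bump leqNgt ltn_ord.
Qed.

Lemma muni_inj : injective (@muni n k).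
Proof. by move=> p q e; apply/mpolyP => m; rewrite -!mcoeff_muni e. Qed.

Lemma muni_surj (q : {poly {mpoly k[n]}}) : exists p : S, muni p = q.
Proof.
have muniX (m : 'X_{1..n.+1}) : muni ('X_[m] : S) = 'X_[lower m] *: 'X^(m ord_max).
  by rewrite muniE msuppX big_seq1 mcoeffX eqxx scale1r.
rewrite -[q]coefK poly_def.
elim/big_ind: _ => [|p1 p2 [q1 <-] [q2 <-]|i _].
- by exists 0; rewrite muni0.
- by exists (q1 + q2); rewrite muniD.
rewrite [q`_i]mpolyE scaler_suml; elim/big_ind: _ => [|p1 p2 [q1 <-] [q2 <-]|m _].
- by exists 0; rewrite muni0.
- by exists (q1 + q2); rewrite muniD.
pose M := [multinom oapp m (val i) (unlift ord_max j) | j < n.+1].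
exists ((q`_i)@_m *: 'X_[M]); rewrite muniZ muniX mnmE unlift_none /= scalerA.
rewrite -mul_mpolyC; congr (_ * 'X_[_] *: _); apply/mnmP => j; rewrite !mnmE.
suff -> : widen_ord (leqnSn n) j = lift ord_max j by rewrite liftK.
by apply: val_inj; rewrite /= /bump leqNgt ltn_ord.
Qed.

Variable i : 'I_n.+1.

(** The exchange of x_i with the last variable makes x_i the variable of the
    univariate polynomial ring. *)
Definition uni_at : S -> {poly {mpoly k[n]}} := @muni n k \o msym (tperm i ord_max).

HB.instance Definition _ := GRing.RMorphism.on uni_at.

Lemma uni_at_inj : injective uni_at.
Proof.
apply: inj_comp; first exact: muni_inj.
move=> p q /(congr1 (msym (tperm i ord_max))).
by rewrite -!msymMm tperm2 !msym1m.
Qed.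

Lemma uni_at_surj q : exists p, uni_at p = q.
Proof.
have [p <-] := muni_surj q; exists (msym (tperm i ord_max) p).
by rewrite /uni_at /= -msymMm tperm2 msym1m.
Qed.

Lemma uni_at_size (p : S) m : m \in msupp p -> (m i < size (uni_at p))%N.
Proof.
rewrite mcoeff_msupp => pm; rewrite ltnNge; apply: contra pm => le.
pose m' := [multinom m (tperm i ord_max j) | j < n.+1].
have -> : p@_m = (msym (tperm i ord_max) p)@_m'.
  by rewrite mcoeff_sym; congr (_@_ _); apply/mnmP=> j; rewrite !mnmE tpermK.
by rewrite -mcoeff_muni nth_default ?mcoeff0 // mnmE tpermR.
Qed.

End LastVariable.

(** The part of the principal ideal theorem needed here.  The case g = 0
    follows from that of a variable. *)
Lemma principal_height_le1 (k : fieldType) n (g : {mpoly k[n.+1]}) :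
  g@_0 = 0 ->
  exists P : prime_idealr {mpoly k[n.+1]}, g \in P /\ ~ prime_height_ge P 2.
Proof.
wlog g0 : g / g != 0.
  move=> W; have [->|/W //] := eqVneq g 0.
  have [||P [_ Ph]] := W 'X_ord_max; last by exists P; split; [apply: idealr0|].
    by rewrite -msupp_eq0 msuppX.
  by rewrite mcoeffX mnm1_eq0.
move=> gc; have [m mg] : exists m, m \in msupp g.
  by exists (mlead g); apply: mlead_supp.
have /eqP : m != 0%MM by apply: contraTneq mg => ->; rewrite mcoeff_msupp gc eqxx.
move=> m0; have [i mi] : exists i, m i != 0%N.
  apply: NNPP => H; apply: m0; apply/mnmP=> i; rewrite mnm0E.
  by apply/eqP/negPn/negP => mi; apply: H; exists i.
have [|f irrf fg] := @irreducible_factor _ (uni_at i g).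
  by apply: leq_trans (uni_at_size i mg); rewrite ltnS lt0n.
have [P defP] := contraction_prime (uni_at i) irrf.
exists P; split; first by rewrite defP.
exact: (contraction_height_le1 (@uni_at_inj _ _ i) (@uni_at_surj _ _ i) irrf defP).
Qed.

(** Otherwise the prime of [principal_height_le1] would contain I. *)
Lemma height2_nonunit (k : fieldType) n (I : idealr {mpoly k[n.+1]}) g :
  height_ge I 2 -> (forall p, p \in I -> divides g p) -> g@_0 != 0.
Proof.
move=> ht Ig; apply/eqP => g0; have [P [gP]] := principal_height_le1 g0.
by apply; apply: ht => p /Ig [z ->]; rewrite mulrC idealMr.
Qed.

(** * Cross products *)

Lemma ord3_ind (P : 'I_3 -> Prop) : P 0 -> P 1 -> P 2 -> forall i, P i.
Proof.
move=> P0 P1 P2 [[|[|[|//]]] lti].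
- by rewrite (_ : Ordinal lti = 0) //; apply: val_inj.
- by rewrite (_ : Ordinal lti = 1) //; apply: val_inj.
- by rewrite (_ : Ordinal lti = 2) //; apply: val_inj.
Qed.

Lemma sum3 (R : nmodType) (F : 'I_3 -> R) : \sum_i F i = F 0 + F 1 + F 2.
Proof.
rewrite !big_ord_recl big_ord0 addr0 addrA; congr (F _ + F _ + F _);
  exact: val_inj.
Qed.

Lemma ord3_add :
  (((0 + 1)%R = 1%R :> 'I_3) * ((0 + 2)%R = 2%R :> 'I_3) *
   ((1 + 1)%R = 2%R :> 'I_3) * ((1 + 2)%R = 0%R :> 'I_3) *
   ((2 + 1)%R = 0%R :> 'I_3) * ((2 + 2)%R = 1%R :> 'I_3))%type.
Proof. by do !split; apply: val_inj. Qed.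

Section Cross.
Variable R : comNzRingType.
Implicit Types (u v w : 'rV[R]_3) (D : 'M[R]_3).

Definition dot u v : R := \sum_i u 0 i * v 0 i.

Definition cross u v : 'rV[R]_3 :=
  \row_i (u 0 (i + 1) * v 0 (i + 2) - u 0 (i + 2) * v 0 (i + 1)).

Lemma cross_cross u v w :
  cross (cross u v) w = dot u w *: v - dot v w *: u.
Proof.
by apply/rowP; apply: ord3_ind; rewrite !mxE /dot !sum3 !ord3_add; ring.
Qed.

Lemma dot_cross_cyclic u v w : dot (cross u v) w = dot u (cross v w).
Proof. by rewrite /dot !sum3 !mxE !ord3_add; ring. Qed.

Lemma crossDl u v w : cross (u + v) w = cross u w + cross v w.
Proof. by apply/rowP => i; rewrite !mxE; ring. Qed.

Lemma crossZl a u v : cross (a *: u) v = a *: cross u v.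
Proof. by apply/rowP => i; rewrite !mxE; ring. Qed.

Lemma crossvv u : cross u u = 0.
Proof. by apply/rowP => i; rewrite !mxE; ring. Qed.

Lemma cross_eq0P u v : cross u v = 0 -> forall i j, u 0 i * v 0 j = u 0 j * v 0 i.
Proof.
move=> /rowP uv.
have := uv 0; have := uv 1; have := uv 2; rewrite !mxE !ord3_add.
move=> /subr0_eq e2 /subr0_eq e1 /subr0_eq e0.
by apply: ord3_ind; apply: ord3_ind; rewrite ?e0 ?e1 ?e2 //.
Qed.

Lemma dot_delta u i : dot (delta_mx 0 i) u = u 0 i.
Proof.
rewrite /dot (bigD1 i) //= big1 ?addr0 ?mxE ?eqxx ?mul1r // => j /negPf ji.
by rewrite mxE ji andbF mul0r.
Qed.

Lemma dotZl a u v : dot (a *: u) v = a * dot u v.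
Proof. by rewrite /dot mulr_sumr; apply: eq_bigr => i _; rewrite mxE mulrA. Qed.

Lemma dotZr a u v : dot u (a *: v) = a * dot u v.
Proof. by rewrite /dot mulr_sumr; apply: eq_bigr => i _; rewrite mxE mulrCA. Qed.

Lemma crossC u v : cross u v = - cross v u.
Proof. by apply/rowP => i; rewrite !mxE; ring. Qed.

(** This recovers u from its cross products with the unit vectors. *)
Lemma cross_delta u i : cross (delta_mx 0 (i + 2)) u 0 (i + 1) = u 0 i.
Proof.
by move: i; apply: ord3_ind; rewrite !mxE !ord3_add /= ?mul1r ?mul0r ?subr0.
Qed.

Definition column D i := row i D^T.

Lemma mulmx_column u D i : (u *m D) 0 i = dot u (column D i).
Proof. by rewrite mxE; apply: eq_bigr => j _; rewrite !mxE. Qed.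

Definition vdivides (a : R) n (u : 'rV[R]_n) := exists v : 'rV[R]_n, u = a *: v.

Lemma vdividesP a n (u : 'rV[R]_n) : vdivides a u <-> forall i, divides a (u 0 i).
Proof.
split=> [[v ->] i|]; first by exists (v 0 i); rewrite mxE.
move=> /fin_all_exists [v uE]; exists (\row_i v i).
by apply/rowP => i; rewrite uE !mxE.
Qed.

End Cross.

(** * Consequences of exactness *)

Section Exact.
Variables (R : idomainType) (y : 'M[R]_(1, 3)) (D : 'M[R]_3) (f : 'M[R]_(3, 1)).
Hypothesis y_inj : forall u : 'rV_1, u *m y = 0 -> u = 0.
Hypothesis exact_yD :
  forall u, u *m D = 0 <-> exists v : 'rV_1, u = v *m y.
Hypothesis exact_Df :
  forall u, u *m f = 0 <-> exists v : 'rV_3, u = v *m D.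

Local Notation C := (column D).

Lemma scale_y_eq0 e : e *: y = 0 -> e = 0.
Proof.
rewrite -mul_scalar_mx => /y_inj /matrixP/(_ 0 0).
by rewrite !mxE eqxx mulr1n.
Qed.

Lemma kerD (u : 'rV_3) : u *m D = 0 -> exists t, u = t *: y.
Proof.
case/exact_yD => v ->; exists (v 0 0).
by rewrite [v]mx11_scalar mul_scalar_mx mxE eqxx mulr1n.
Qed.

Lemma yD0 : y *m D = 0.
Proof. by apply/exact_yD; exists 1%:M; rewrite mul1mx. Qed.

Lemma Df0 : D *m f = 0.
Proof.
apply/row_matrixP => i; rewrite row0 row_mul; apply/exact_Df.
by exists (delta_mx 0 i); rewrite -rowE.
Qed.

Lemma dot_column_y i : dot (C i) y = 0.
Proof.
have := mulmx_column y D i; rewrite yD0 mxE => ->.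
by apply: eq_bigr => j _; rewrite mulrC.
Qed.

(** A diagram chase: if th is nonzero and u D = th q, then q is killed by f, so
    q = p D and u - th p is killed by D. *)
Lemma exact_yD_mod th (u : 'rV_3) : vdivides th (u *m D) ->
  exists t p, u = t *: y + th *: p.
Proof.
case=> q uD; have [th0|th0] := eqVneq th 0.
  have [|t ->] := @kerD u; first by rewrite uD th0 scale0r.
  by exists t, 0; rewrite scaler0 addr0.
have [|p qE] := (exact_Df q).1.
  have : th *: (q *m f) = 0 by rewrite scalemxAl -uD -mulmxA Df0 mulmx0.
  by move/eqP; rewrite scalemx_eq0 (negPf th0) => /eqP.
have [|t uE] := @kerD (u - th *: p).
  by rewrite mulmxBl -scalemxAl -qE uD subrr.
by exists t, p; rewrite -uE subrK.
Qed.

(** The same chase one step to the left; that is, the ideal generated by the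
    entries of y has grade at least 2. *)
Lemma divides_scale_y th e : vdivides th (e *: y) -> divides th e.
Proof.
case=> p ey; have [th0|th0] := eqVneq th 0.
  exists 0; rewrite mulr0; apply: scale_y_eq0; by rewrite ey th0 scale0r.
have [|t pE] := @kerD p.
  have : th *: (p *m D) = 0 by rewrite scalemxAl -ey -scalemxAl yD0 scaler0.
  by move/eqP; rewrite scalemx_eq0 (negPf th0) => /eqP.
exists t; apply/subr0_eq/scale_y_eq0.
by rewrite scalerBl ey pE scalerA subrr.
Qed.

(** The ideal of 2 x 2 minors of D has grade at least 2.  Modulo th, the vector
    e (w x C_i) is orthogonal to all columns, its products with them being e
    times combinations of minors; so it is a multiple of y.  Taking the cross product with
    y and expanding the double product leaves e (w . y) C_i = 0, for all w;
    hence e C_i = 0.  Then e w is orthogonal to all columns, so a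
    multiple of y, for all w, and a last cross product with y gives e y = 0. *)
Lemma divides_minors th e :
  (forall i : 'I_3, vdivides th (e *: cross (C (i + 1)) (C (i + 2)))) -> divides th e.
Proof.
move=> minors; have {minors} minors i j : vdivides th (e *: cross (C i) (C j)).
  have opp u v : vdivides th (e *: cross u v) -> vdivides th (e *: cross v u).
    by case=> q qE; exists (- q); rewrite crossC scalerN qE scalerN.
  have := minors 0; have := minors 1; have := minors 2; rewrite !ord3_add.
  move: i j; do 2!apply: ord3_ind; rewrite ?crossvv ?scaler0 => // *;
    try (by exists 0; rewrite scaler0); by [|apply: opp].
(* The entries of D are dealt with one at a time, w being a unit vector. *)
have eD i l : divides th (e * C i 0 l).
  apply: divides_scale_y; apply/vdividesP => j; pose w : 'rV[R]_3 := delta_mx 0 j.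
  have [|t [p E]] := @exact_yD_mod th (e *: cross w (C i)).
    apply/vdividesP => m; have [q qE] := minors i m.
    rewrite mulmx_column dotZl dot_cross_cyclic -dotZr qE dotZr.
    by eexists.
  have /rowP/(_ l) := congr1 (fun v => cross v y) E.
  rewrite crossZl cross_cross dot_column_y scale0r subr0 dot_delta.
  rewrite crossDl !crossZl crossvv scaler0 add0r !mxE => E'.
  by exists (cross p y 0 l); rewrite !mxE -E'; ring.
apply: divides_scale_y; apply/vdividesP => j; pose w : 'rV[R]_3 := delta_mx 0 (j + 2).
have [|t [p E]] := @exact_yD_mod th (e *: w).
  apply/vdividesP => i; rewrite -scalemxAl mxE -rowE.
  by have [z zE] := eD i (j + 2); exists z; rewrite -zE !mxE.
have /rowP/(_ (j + 1)) := congr1 (fun v => cross v y) E.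
rewrite crossDl !crossZl crossvv scaler0 add0r mxE cross_delta => E'.
by exists (cross p y 0 (j + 1)); rewrite mxE E' mxE.
Qed.

Lemma y_neq0 : exists j, y 0 j != 0.
Proof.
apply/existsP; apply: contraT => /existsPn y0.
suff /eqP : 1 = 0 :> R by rewrite oner_eq0.
apply: scale_y_eq0.
apply/rowP => j; rewrite !mxE mul1r; apply/eqP/negPn/y0.
Qed.

(** The cross products of the columns are multiples t_i of y, those of the rows
    are then multiples y_j of t, and the latter are proportional to f.  To find g,
    fix t_i nonzero: f_i times any minor is a multiple of t_i, so f_i is. *)
Lemma rank_two_factorization : exists t : 'rV_3,
  (forall i : 'I_3, cross (C (i + 1)) (C (i + 2)) = t 0 i *: y) /\
  exists g, f^T = g *: t.
Proof.
have /fin_all_exists [t tE] (i : 'I_3) : exists c, cross (C (i + 1)) (C (i + 2)) = c *: y.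
  apply: kerD.
  apply/rowP => k; rewrite mulmx_column mxE; set m := cross _ _.
  have /cross_eq0P my : cross m y = 0.
    by rewrite cross_cross !dot_column_y !scale0r subrr.
  apply: (@scale_y_eq0 (dot m (C k))); apply/rowP => b; rewrite !mxE.
  transitivity (m 0 b * dot (C k) y); last by rewrite dot_column_y mulr0.
  rewrite /dot mulr_suml mulr_sumr.
  by apply: eq_bigr => a _; rewrite mulrAC my; ring.
have rowE' j : cross (row (j + 1) D) (row (j + 2) D) = y 0 j *: \row_i t i.
  apply/rowP => i; rewrite [RHS]mxE mxE mulrC.
  by have /rowP/(_ j) := tE i; rewrite !mxE => <-; ring.
have tf : cross (\row_i t i) f^T = 0.
  have [j yj] := y_neq0.
  have dot0 l : dot (row l D) f^T = 0.
    have /matrixP/(_ l 0) := Df0; rewrite !mxE => <-.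
    by apply: eq_bigr => m _; rewrite !mxE.
  have := cross_cross (row (j + 1) D) (row (j + 2) D) f^T.
  rewrite rowE' crossZl !dot0 !scale0r subrr => /eqP.
  by rewrite scalemx_eq0 (negPf yj) => /eqP.
have {}tf a b : t a * f b 0 = t b * f a 0.
  by have := cross_eq0P tf a b; rewrite !mxE.
exists (\row_i t i); split=> [i|]; first by rewrite mxE.
have [i0 ti0] : exists i, t i != 0.
  apply/existsP; apply: contraT => /existsPn t0.
  have [i|z /eqP] := @divides_minors 0 1; last by rewrite mul0r oner_eq0.
  by exists 0; have /negPn/eqP ti := t0 i; rewrite tE ti !scale0r scaler0.
have [i|g gE] := @divides_minors (t i0) (f i0 0).
  by exists (f i 0 *: y); rewrite tE !scalerA -tf mulrC.
exists g; apply/rowP => i; rewrite !mxE; apply: (mulfI ti0).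
by rewrite tf gE; ring.
Qed.


(** If y_0 = y_1 = 0, then y_2 is a unit by [divides_scale_y].  Suppose that
    y_0 = 0 and that y_1 is nonzero.  Then y_1 D_1 + y_2 D_2 = 0 for the rows D_1
    and D_2, and as y_1 and y_2 have no common factor, D_2 = y_1 q with q a
    syzygy of f, so q = p D.  Thus e_2 - y_1 p is killed by D and is a multiple
    of y, and its last coordinate is the relation sought. *)
Lemma y_coord0_unit_ideal : y 0 0 = 0 -> exists u v, 1 = y 0 1 * u + y 0 2 * v.
Proof.
move=> y0; have yE i : y 0 1 * D 1 i + y 0 2 * D 2 i = 0.
  by have /rowP/(_ i) := yD0; rewrite !mxE sum3 y0 mul0r add0r.
have [y1|y1] := eqVneq (y 0 1) 0.
  have [|z ->] := @divides_scale_y (y 0 2) 1; last by exists 0, z; rewrite mulr0 add0r.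
  apply/vdividesP; apply: ord3_ind; rewrite mxE mul1r ?y0 ?y1.
  - by exists 0; rewrite mulr0.
  - by exists 0; rewrite mulr0.
  - by exists 1; rewrite mulr1.
have /fin_all_exists [q qE] i : exists z, D 2 i = y 0 1 * z.
  apply: divides_scale_y; apply/vdividesP; apply: ord3_ind; rewrite mxE.
  - by exists 0; rewrite y0 !mulr0.
  - by exists (D 2 i); rewrite mulrC.
  - by exists (- D 1 i); rewrite mulrN mulrC; apply/eqP; rewrite -addr_eq0 addrC yE.
have rowqE : row 2 D = y 0 1 *: \row_i q i by apply/rowP => i; rewrite !mxE.
have [|p pE] := (exact_Df (\row_i q i)).1.
  apply/eqP; have: row 2 D *m f == 0 by rewrite -row_mul Df0 row0.
  by rewrite rowqE -scalemxAl scalemx_eq0 (negPf y1).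
have [|t /rowP/(_ 2)] := @kerD (delta_mx 0 2 - y 0 1 *: p).
  by rewrite mulmxBl -rowE -scalemxAl -pE rowqE subrr.
rewrite !mxE /= => /(canRL (subrK _)) E; exists (p 0 2), t.
by rewrite [1]E addrC (mulrC t).
Qed.

End Exact.

(** * Homogeneous parts *)

Section Grading.
Variables (k : fieldType) (r : nat).
Local Notation S := {mpoly k[r]}.
Implicit Types (d e : int) (p q : S).

Definition homog_part d p : S := if d is Posz n then pihomog mdeg n p else 0.

Lemma homog_part_additive d : additive (homog_part d).
Proof. by case: d => n p q /=; [rewrite raddfB | rewrite subrr]. Qed.

HB.instance Definition _ d := GRing.isAdditive.Build S S (homog_part d) (homog_part_additive d).

Lemma homog_part_id d p : homog_of_degree d p -> homog_part d p = p.
Proof. by case: d => n /= => [/pihomog_dE|->]. Qed.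

Lemma homog_part_is_homog d p : homog_of_degree d (homog_part d p).
Proof. by case: d => n //=; apply: pihomogP. Qed.

Lemma homog_part_neq d e p : homog_of_degree d p -> d != e -> homog_part e p = 0.
Proof.
case: d => m /= hp; last by rewrite hp raddf0.
by case: e => n //= ne; apply: pihomog_ne0 hp.
Qed.

Lemma homogM d e p q :
  homog_of_degree d p -> homog_of_degree e q -> homog_of_degree (d + e) (p * q).
Proof.
case: d => m /= hp; last first.
  by rewrite hp mul0r; case: (Negz m + e) => n //= _; apply: dhomog0.
case: e => n /= hq; first exact: dhomogM.
by rewrite hq mulr0; case: (Posz m + Negz n) => l //=; apply: dhomog0.
Qed.

Lemma homogB d p q :
  homog_of_degree d p -> homog_of_degree d q -> homog_of_degree d (p - q).
Proof.
case: d => m /= hp hq; last by rewrite hp hq subrr.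
by rewrite rpredB.
Qed.

Lemma homog_partM d e p q : homog_of_degree e q ->
  homog_part d (p * q) = homog_part (d - e) p * q.
Proof.
move=> hq; rewrite [p]mpolyE mulr_suml !raddf_sum mulr_suml /=.
apply: eq_bigr => m _; set x := _ *: _.
have hx : homog_of_degree (mdeg m) x by apply: dhomogZ; rewrite dhomogX.
have [de|de] := eqVneq (Posz (mdeg m)) (d - e).
  rewrite -de [homog_part _ x]homog_part_id // homog_part_id //.
  have -> : d = Posz (mdeg m) + e by rewrite de subrK.
  exact: homogM.
rewrite (homog_part_neq hx de) mul0r (homog_part_neq (homogM hx hq)) //.
by apply: contra de => /eqP <-; rewrite addrK.
Qed.

Lemma mcoeff0M p q : (p * q)@_0%MM = p@_0%MM * q@_0%MM.
Proof. exact: rmorphM. Qed.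

Lemma mcoeff_pihomog n p m : mdeg m = n -> (pihomog mdeg n p)@_m = p@_m.
Proof.
move=> <-; rewrite pihomogE [in RHS](mpolyE p) !raddf_sum /= [LHS]big_mkcond.
apply: eq_bigr => m' _; case: eqP => // ne; rewrite mcoeffZ mcoeffX.
by case: eqP ne => [->|_ _] //; rewrite mulr0.
Qed.

(** Only the lowest homogeneous part of g can contribute to the part of g q in
    the degree of q, and that contribution is nonzero. *)
Lemma homog_factor_degree d e p q g :
  homog_of_degree d p -> homog_of_degree e q -> p != 0 -> p = g * q ->
  g@_0%MM != 0 -> d = e.
Proof.
move=> hp hq p0 pE g0; apply/eqP; apply: contraNT g0 => de.
have : homog_part e p = 0 by apply: homog_part_neq hp de.
rewrite pE (homog_partM _ _ hq) subrr => /eqP; rewrite mulf_eq0 orbC.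
have [q0|_ /= /eqP g0] := eqVneq q 0; first by rewrite pE q0 mulr0 eqxx in p0.
by rewrite -(mcoeff_pihomog g mdeg0) g0 mcoeff0.
Qed.

End Grading.

(** * Necessity of the conditions *)

Section Necessity.
Variables (k : fieldType) (n : nat).
Local Notation S := {mpoly k[n.+1]}.
Variables (I : idealr S) (a b : 'I_3 -> int) (s : int).
Variables (f : 'M[S]_(3, 1)) (D : 'M[S]_3) (y : 'M[S]_(1, 3)).
Hypothesis htI : height_ge I 2.
Hypotheses (f_graded : graded_map a (fun=> 0) f) (D_graded : graded_map b a D)
  (y_graded : graded_map (fun=> s) b y).
Hypotheses (f_min : minimal_map f) (D_min : minimal_map D) (y_min : minimal_map y).
Hypothesis I_f : forall p, p \in I <-> exists u : 'rV[S]_3, p%:M = u *m f.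
Hypotheses (exact_Df : exact_at D f) (exact_yD : exact_at y D)
  (y_inj : forall u : 'rV[S]_1, u *m y = 0 -> u = 0).

Lemma gens_divisor_nonunit g : (forall i, divides g (f i 0)) -> g@_0%MM != 0.
Proof.
move=> /fin_all_exists [z zE]; apply: (height2_nonunit htI) => p /I_f [u].
move/matrixP/(_ 0 0); rewrite !mxE eqxx mulr1n => ->.
exists (\sum_i u 0 i * z i); rewrite mulr_sumr; apply: eq_bigr => i _.
by rewrite zE mulrCA.
Qed.

Lemma gens_no_proper_divisor g : g@_0%MM = 0 -> ~ forall i, divides g (f i 0).
Proof. by move=> g0 /gens_divisor_nonunit; rewrite g0 eqxx. Qed.

Lemma f_neq0 : exists i, f i 0 != 0.
Proof.
apply/existsP; apply: contraT => /existsPn f0.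
exfalso; apply: (@gens_no_proper_divisor 0) => [|i]; first exact: mcoeff0.
by exists 0; have /negPn/eqP -> := f0 i; rewrite mulr0.
Qed.

(** Compare the degrees of f_i y_j = g t_i y_j and of t_i y_j, which is a 2 x 2
    minor of D. *)
Lemma degree_sum : s = \sum_i b i - \sum_i a i.
Proof.
have [t [tE [g gE]]] := rank_two_factorization y_inj exact_yD exact_Df.
have fE i : f i 0 = g * t 0 i by have /rowP/(_ i) := gE; rewrite !mxE.
have g0 : g@_0%MM != 0 by apply: gens_divisor_nonunit => i; exists (t 0 i).
have [i fi] := f_neq0; have [j yj] := y_neq0 y_inj.
pose m := cross (column D (i + 1)) (column D (i + 2)) 0 j.
have hm : homog_of_degree (b (j + 1) + b (j + 2) - (a (i + 1) + a (i + 2))) m.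
  rewrite /m !mxE; apply: homogB.
    have := homogM (D_graded (j + 1) (i + 1)) (D_graded (j + 2) (i + 2)).
    by congr homog_of_degree; ring.
  have := homogM (D_graded (j + 2) (i + 1)) (D_graded (j + 1) (i + 2)).
  by congr homog_of_degree; ring.
have := homog_factor_degree (homogM (f_graded i 0) (y_graded 0 j)) hm
  (mulf_neq0 fi yj) _ g0.
rewrite fE -mulrA /m tE mxE => /(_ erefl).
have cyc (c : 'I_3 -> int) l : \sum_l c l = c l + (c (l + 1) + c (l + 2)).
  by rewrite sum3; move: l; apply: ord3_ind; rewrite ?ord3_add; ring.
by rewrite (cyc a i) (cyc b j) => e; lia.
Qed.

(** The first entry of y is nonzero, because otherwise the other two, which have
    no constant term, would generate the unit ideal. *)
Lemma b0_lt_s : b 0 < s.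
Proof.
have y0 : y 0 0 != 0.
  apply/negP => /eqP /(y_coord0_unit_ideal y_inj exact_yD exact_Df) [u [v]].
  move/(congr1 (mcoeff 0%MM)); rewrite mcoeffD mcoeff1 eqxx.
  by rewrite !mcoeff0M !y_min !mul0r addr0 => /eqP; rewrite oner_eq0.
rewrite ltNge; apply: contra y0 => le_sb; have := y_graded 0 0.
have := y_min 0 0; case E: (s - b 0) => [[|d]|d] /= yc; try lia; last by move->.
move=> /dhomogP hy; apply/eqP/mpolyP => m; rewrite mcoeff0.
have [->//|] := eqVneq m 0%MM.
rewrite -mdeg_eq0; apply: contraNeq => ym; apply/eqP/hy.
by rewrite mcoeff_msupp.
Qed.

Definition koszul i j : 'rV[S]_3 := f i 0 *: delta_mx 0 j - f j 0 *: delta_mx 0 i.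

Lemma koszulE i j l : koszul i j 0 l = f i 0 *+ (l == j) - f j 0 *+ (l == i).
Proof. by rewrite !mxE eqxx /= !mulr_natr. Qed.

(** In any expression of a Koszul relation by the rows of D one may keep the
    homogeneous parts of the coefficients in the right degree; a coefficient
    of negative degree vanishes. *)
Lemma koszul_lift i j : exists2 v : 'rV_3, koszul i j = v *m D &
  forall l, homog_of_degree (a i + a j - b l) (v 0 l).
Proof.
have [v vE] : exists v : 'rV_3, koszul i j = v *m D.
  apply/exact_Df; rewrite mulmxBl -!scalemxAl -!rowE; apply/rowP => l.
  by rewrite ord1 !mxE mulrC subrr.
exists (\row_l homog_part (a i + a j - b l) (v 0 l)) => [|l]; last first.
  by rewrite mxE; apply: homog_part_is_homog.
apply/rowP => l; have hk : homog_of_degree (a i + a j - a l) (koszul i j 0 l).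
  have h0 : forall d, homog_of_degree d (0 : S) by case=> d //=; apply: dhomog0.
  rewrite koszulE; apply: homogB; case: eqP => [->|_] //=.
    by have := f_graded i 0; congr homog_of_degree; ring.
  by have := f_graded j 0; congr homog_of_degree; ring.
rewrite -[LHS](homog_part_id hk) vE !mxE raddf_sum /=; apply: eq_bigr => m _.
by rewrite (homog_partM _ _ (D_graded m l)) mxE; congr (homog_part _ _ * _); ring.
Qed.

Lemma homog_neg d (p : S) : d < 0 -> homog_of_degree d p -> p = 0.
Proof. by case: d. Qed.

(** Otherwise the relation between f_0 and f_1 is zero, so these vanish and f_2
    generates I. *)
Lemma b2_le_a01 : b 2 <= b 1 -> b 1 <= b 0 -> b 2 <= a 0 + a 1.
Proof.
move=> b21 b10; rewrite leNgt; apply/negP => lt.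
have [v kv hv] := koszul_lift 0 1.
have v0 : v = 0.
  by apply/rowP; apply: ord3_ind; rewrite mxE; apply: homog_neg (hv _); lia.
apply: (@gens_no_proper_divisor (f 2 0)) => //.
move: kv; rewrite v0 mul0mx => /rowP kv.
have := kv 0; have := kv 1; rewrite !koszulE !mxE /= !mulr1n !mulr0n subr0 sub0r.
move=> f0 /eqP; rewrite oppr_eq0 => /eqP f1.
apply: ord3_ind; rewrite ?f0 ?f1; first [by exists 0; rewrite mulr0 | by exists 1; rewrite mulr1].
Qed.

(** Otherwise the relations of f_0 with f_1 and with f_2 are both multiples c and d of
    the last row of D.  They are linearly independent unless f_0 = 0, and in
    that case they exhibit f_1 and f_2 as multiples of the first entry of
    that row. *)
Lemma b1_le_a02 : b 1 <= b 0 -> a 1 <= a 2 -> b 1 <= a 0 + a 2.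
Proof.
move=> b10 a12; rewrite leNgt; apply/negP => lt.
have lift j : a j <= a 2 -> exists c, forall l, koszul 0 j 0 l = c * D 2 l.
  move=> aj; have [v -> hv] := koszul_lift 0 j; exists (v 0 2) => l.
  rewrite mxE sum3 [v 0 0](homog_neg _ (hv _)) ?[v 0 1](homog_neg _ (hv _)); try lia.
  by rewrite !mul0r !add0r.
have [c cE] := lift 1 a12; have [d dE] := lift 2 (lexx _).
have := cE 1; have := cE 0; have := dE 2; have := dE 1; have := dE 0.
rewrite !koszulE /= !mulr1n !mulr0n !subr0 !sub0r => f2 d1 d2 f1 c1.
(* f_0 = c D_21 and f_0 = d D_22, while d D_21 = 0: hence f_0 ^ 2 = 0. *)
have f0 : f 0 0 = 0.
  by apply/eqP; rewrite -[_ == 0]orbb -mulf_eq0 {1}c1 d2 mulrACA [c * d]mulrC mulrACA -d1 mul0r.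
apply: (@gens_no_proper_divisor (D 2 0)) => //.
apply: ord3_ind; [exists 0 | exists (- c) | exists (- d)].
- by rewrite f0 mulr0.
- by rewrite -[f 1 0]opprK f1; ring.
- by rewrite -[f 2 0]opprK f2; ring.
Qed.

(** Otherwise no Koszul relation involves the first row D_0.  But
    f_i D_0 = sum_j D_0j (f_i e_j - f_j e_i), as D_0 is a syzygy of f, so f_i D_0 is a
    combination of the other rows; this is a relation between the rows of D whose
    first coefficient is f_i, hence a multiple of y. *)
Lemma b0_le_a12 : a 0 <= a 1 -> a 1 <= a 2 -> b 0 <= a 1 + a 2.
Proof.
move=> a01 a12; rewrite leNgt; apply/negP => lt.
have lift i j : exists2 v : 'rV_3, koszul i j = v *m D & v 0 0 = 0.
  have [->|ij] := eqVneq i j.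
    by exists 0; [rewrite mul0mx /koszul subrr | rewrite mxE].
  have [v vE hv] := koszul_lift i j; exists v => //.
  apply: homog_neg (hv 0); move: i j ij {v vE hv}.
  by do 2!apply: ord3_ind; rewrite ?eqxx //; lia.
apply: (@gens_no_proper_divisor (y 0 0)) => //.
move=> i; have /fin_all_exists2 [v vE v0] := lift i.
have [|t /rowP/(_ 0)] :=
  @kerD _ y D exact_yD (f i 0 *: delta_mx 0 0 - \sum_j D 0 j *: v j).
  apply/eqP; rewrite mulmxBl -scalemxAl -rowE mulmx_suml subr_eq0; apply/eqP.
  under eq_bigr => j _ do rewrite -scalemxAl -vE scalerBr !scalerA.
  rewrite sumrB -scaler_suml.
  have -> : \sum_j D 0 j * f j 0 = 0.
    by have /matrixP/(_ 0 0) := Df0 exact_Df; rewrite !mxE.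
  rewrite scale0r subr0; apply/rowP => l; rewrite summxE (bigD1 l) //= big1.
    by rewrite !mxE !eqxx addr0 mulr1 mulrC.
  by move=> j /negPf jl; rewrite !mxE eq_sym jl andbF mulr0.
rewrite !mxE summxE big1 ?subr0 ?eqxx ?mulr1 => [->|j _].
  by exists t; rewrite mulrC.
by rewrite mxE v0 mulr0.
Qed.

End Necessity.

(** * Divisibility by powers of a variable *)

Section Monomials.
Variables (k : fieldType) (n : nat).
Local Notation S := {mpoly k[n]}.
Implicit Types (i j : 'I_n) (p q : S) (m : 'X_{1..n}) (c d : nat).

(** The remainders of the division by x_i^c. *)
Definition reduced i c p := forall m, (c <= m i)%N -> p@_m = 0.

Lemma reducedB i c p q : reduced i c p -> reduced i c q -> reduced i c (p - q).
Proof. by move=> hp hq m cm; rewrite mcoeffB hp // hq // subrr. Qed.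

Lemma reducedM i j c d p : i != j -> reduced i c p -> reduced i c ('X_j ^+ d * p).
Proof.
move=> ij hp m cm; rewrite [p]mpolyE mulr_sumr raddf_sum /=.
apply: big1 => m' _; rewrite -scalerAr mcoeffZ mpolyXn -mpolyXD mcoeffX.
case: eqP => [me|]; last by rewrite mulr0.
rewrite hp ?mul0r //; move: cm; rewrite -me mnmDE mulmnE mnm1E.
by rewrite eq_sym (negPf ij) mul0n.
Qed.

Lemma reduced_multiple i c p : reduced i c ('X_i ^+ c * p) -> p = 0.
Proof.
move=> hp; apply/mpolyP => m; rewrite mcoeff0 -(mcoeffMX p (U_(i) *+ c)%MM).
by rewrite mulrC -mpolyXn; apply: hp; rewrite mnmDE mulmnE mnm1E eqxx mul1n leq_addr.
Qed.

Lemma division i c p : exists q t,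
  p = 'X_i ^+ c * q + t /\ reduced i c t.
Proof.
pose t := \sum_(m <- msupp p | ~~ (c <= m i)%N) p@_m *: 'X_[m] : S.
pose q := \sum_(m <- msupp p | (c <= m i)%N) p@_m *: 'X_[m - U_(i) *+ c] : S.
have tE m : t@_m = if (c <= m i)%N then 0 else p@_m.
  rewrite [in RHS](mpolyE p) !raddf_sum big_mkcond /=.
  case: ifP => cm; first apply: big1 => m' _; last apply: eq_bigr => m' _.
    case: ifP => // cm'; rewrite mcoeffZ mcoeffX.
    by case: eqP cm' => [->|]; rewrite ?cm ?mulr0.
  case: ifP => //; rewrite mcoeffZ mcoeffX.
  by case: eqP => [->|]; rewrite ?cm ?mulr0.
exists q, t; split=> [|m cm]; last by rewrite tE cm.
  rewrite [LHS]mpolyE (bigID (fun m : 'X_{1..n} => (c <= m i)%N)) /=; congr (_ + _).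
  rewrite mulr_sumr; apply: eq_bigr => m cm.
  rewrite -scalerAr mpolyXn -mpolyXD addmC submK //.
  apply/mnm_lepP => j; rewrite mulmnE mnm1E.
  by case: eqP => [<-|]; rewrite ?mul1n.
Qed.

Lemma divides_coprime_power i j c d p : i != j ->
  divides ('X_i ^+ c) ('X_j ^+ d * p) -> divides ('X_i ^+ c) p.
Proof.
move=> ij [z pE]; have [q [t [pqt ht]]] := division i c p.
have t0 : 'X_j ^+ d * t = 0.
  have E : 'X_j ^+ d * t = 'X_i ^+ c * (z - 'X_j ^+ d * q).
    by rewrite mulrBr -pE pqt; ring.
  have := reducedM d ij ht; rewrite E => /reduced_multiple ->.
  by rewrite mulr0.
exists q; rewrite pqt; move/eqP: t0; rewrite mulf_eq0 expf_eq0.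
by rewrite -msupp_eq0 msuppX andbF => /eqP ->; rewrite addr0.
Qed.

(** After reduction of p to t and of v to z modulo x_i^c, the difference
    x_l^e t - x_j^d z is both reduced and a multiple of x_i^c; so it vanishes and
    x_j^d divides t.  Together with [divides_coprime_power], this says that
    powers of distinct variables form a regular sequence. *)
Lemma powers_regular (i j l : 'I_n) c d e p : i != j -> i != l -> j != l ->
  forall u v, 'X_l ^+ e * p = 'X_i ^+ c * u + 'X_j ^+ d * v ->
  exists u' v', p = 'X_i ^+ c * u' + 'X_j ^+ d * v'.
Proof.
move=> ij il jl u v pE; have [u' [t [pu' ht]]] := division i c p.
have [w [z [vw hz]]] := division i c v.
have E : 'X_l ^+ e * t - 'X_j ^+ d * z
       = 'X_i ^+ c * (u + 'X_j ^+ d * w - 'X_l ^+ e * u').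
  transitivity ('X_l ^+ e * p - 'X_i ^+ c * ('X_l ^+ e * u') - 'X_j ^+ d * z).
    by rewrite pu'; ring.
  by rewrite pE vw; ring.
have := reducedB (reducedM e il ht) (reducedM d ij hz).
rewrite E => /reduced_multiple E0; move: E; rewrite E0 mulr0 => /subr0_eq tz.
have [|v' tv'] := @divides_coprime_power j l d e t jl; first by exists z.
by exists u', v'; rewrite pu' tv'.
Qed.

(** Membership in a monomial ideal is decided monomial by monomial, which makes
    it decidable and the ideal homogeneous. *)
Lemma monomial_ideal l (e : 'I_l -> 'X_{1..n}) : (forall h, e h != 0%MM) ->
  exists I : idealr S, homogeneous_ideal I /\
    forall p, p \in I <-> exists u : 'rV[S]_l, p = \sum_h u 0 h * 'X_[e h].
Proof.
move=> e0; pose P := [pred p : S | all (fun m => [exists h, (e h <= m)%MM]) (msupp p)].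
have PP p : reflect (forall m, p@_m != 0 -> exists h, (e h <= m)%MM) (p \in P).
  apply: (iffP allP) => H m; first by rewrite -mcoeff_msupp => /H /existsP.
  by rewrite mcoeff_msupp => /H ex; apply/existsP.
have [|I IP] := @idealr_of_closed _ P.
  split=> [||p q r]; first by rewrite inE msupp0.
    apply/PP => /(_ 0%MM); rewrite mcoeff1 eqxx oner_eq0 => /(_ isT) [i].
    move/mnm_lepP => ei; case/eqP: (e0 i); apply/mnmP => j.
    by have := ei j; rewrite mnm0E leqn0 => /eqP.
  move=> /PP hq /PP hr; apply/PP => m; rewrite -mcoeff_msupp => /msuppD_le.
  rewrite mem_cat => /orP[/msuppM_le /allpairsP[[m1 m2] /= [_ h2 ->]]|].
    rewrite mcoeff_msupp in h2; have [i /mnm_lepP ei] := hq _ h2.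
    by exists i; apply/mnm_lepP => j; rewrite mnmDE (leq_trans (ei j)) ?leq_addl.
  by rewrite mcoeff_msupp; apply: hr.
exists I; split=> [p|p].
  rewrite !IP => /PP hp d; rewrite IP; apply/PP => m pm; apply: hp.
  move: pm; have [md|md] := eqVneq (mdeg m) d; first by rewrite mcoeff_pihomog.
  have /dhomogP/(_ m) := pihomogP mdeg d p; rewrite mcoeff_msupp => H.
  by move/H => /eqP; rewrite (negPf md).
rewrite IP; split=> [/PP hp|[u ->]].
  rewrite [p]mpolyE big_seq; elim/big_ind: _ => [|_ _ [u ->] [v ->]|m].
  - by exists 0; rewrite big1 // => i _; rewrite mxE mul0r.
  - by exists (u + v); rewrite -big_split; apply: eq_bigr => i _; rewrite mxE mulrDl.
  rewrite mcoeff_msupp => /hp [i ei]; exists ((p@_m *: 'X_[m - e i]) *: delta_mx 0 i).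
  rewrite (bigD1 i) //= big1 => [|j /negPf ji].
    by rewrite !mxE !eqxx mulr1 addr0 -scalerAl -mpolyXD submK.
  by rewrite !mxE ji mulr0 mul0r.
rewrite -IP; apply: rpred_sum => i _; apply: idealMr; rewrite IP.
apply/PP => m; rewrite mcoeffX; have [<- _|_] := eqVneq (e i) m; last by rewrite eqxx.
by exists i; apply/mnm_lepP => j.
Qed.

Lemma kernel_prime (R R' : idomainType) (phi : {rmorphism R -> R'}) :
  exists P : prime_idealr R, P =i [pred x | phi x == 0].
Proof.
apply: prime_idealr_of_closed => [|u v]; last by rewrite !inE rmorphM mulf_eq0.
split=> [||a u v]; rewrite !inE ?rmorph0 ?rmorph1 ?oner_eq0 ?eqxx //.
by rewrite rmorphD rmorphM => /eqP-> /eqP->; rewrite mulr0 addr0.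
Qed.

Lemma prime_expr (R : comNzRingType) (P : prime_idealr R) x d :
  x ^+ d \in P -> x \in P.
Proof.
elim: d => [|d IH]; first by rewrite expr0 idealr1.
by rewrite exprS prime_idealrM => /orP[].
Qed.

(** The chain is 0 < (x_i) < P, where (x_i) is the kernel of the substitution
    [kill] of 0 for x_i. *)
Lemma two_variables_height (P : prime_idealr S) i j :
  i != j -> 'X_i \in P -> 'X_j \in P -> prime_height_ge P 2.
Proof.
move=> ij iP jP.
pose kill : {rmorphism S -> S} :=
  comp_mpoly [tuple if l == i then 0 else 'X_l | l < n].
have killX l : kill 'X_l = if l == i then 0 else 'X_l.
  by rewrite /kill /= comp_mpolyXU -tnth_nth tnth_mktuple.
have killZ (c : k) p : kill (c *: p) = c *: kill p by exact: comp_mpolyZ.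
have Xn0 l : 'X_l != 0 :> S by rewrite -msupp_eq0 msuppX.
have killP p : kill p = 0 -> p \in P.
  have [q [t [-> ht]]] := division i 1 p.
  have -> : kill ('X_i ^+ 1 * q + t) = t.
    rewrite rmorphD rmorphM expr1 killX eqxx mul0r add0r [in LHS](mpolyE t) [in RHS](mpolyE t).
    rewrite rmorph_sum; apply: eq_big_seq => m; rewrite mcoeff_msupp => tm.
    rewrite killZ !mpolyXE_id rmorph_prod; congr (_ *: _).
    apply: eq_bigr => l _; rewrite rmorphXn /= killX; case: eqP => // ->.
    have -> : m i = 0%N; last by rewrite !expr0.
    by apply/eqP; apply: contraNT tm; rewrite -lt0n => /ht ->.
  by move=> ->; rewrite addr0 mulrC idealMr // expr1.
have [P0 P0E] := kernel_prime (@idfun S); have [P1 P1E] := kernel_prime kill.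
exists (fun l => if l is l'.+1 then if l' is 0 then P1 else P else P0).
split=> [|//] [_|[_|//]]; split=> [p|].
- by rewrite P0E P1E !inE => /eqP /= ->; rewrite rmorph0.
- by exists 'X_i; rewrite ?P0E ?P1E inE ?killX ?eqxx //= Xn0.
- by rewrite P1E inE => /eqP; apply: killP.
- by exists 'X_j => //; rewrite P1E inE killX (eq_sym j) (negPf ij) Xn0.
Qed.

End Monomials.

(** * The monomial resolution *)

Section Construction.
Variable k : fieldType.
Local Notation S := {mpoly k[3]}.
Variables (a b : 'I_3 -> int) (s : int).
Hypothesis sE : s = \sum_i b i - \sum_i a i.
Hypothesis b_lt : forall i, b i < s.
Hypothesis ab_le : forall i, a i + b i <= \sum_i a i.

Definition yexp i := absz (s - b i)%R.
Definition mexp i := absz ((\sum_l a l) - a i - b i)%R.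

Lemma yexpE i : yexp i = s - b i :> int.
Proof. by rewrite /yexp; have := b_lt i; lia. Qed.

Lemma mexpE i : mexp i = (\sum_l a l) - a i - b i :> int.
Proof. by rewrite /mexp; have := ab_le i; lia. Qed.

Definition ypow (i : 'I_3) : S := 'X_i ^+ yexp i.
Definition mpow (i : 'I_3) : S := 'X_(i + 1) ^+ mexp i.

Definition d3 : 'rV[S]_3 := \row_i ypow i.
(** Row j is the cross product of the j-th unit vector with y, so that v is sent
    to the cross product of v and y with coordinates scaled by the m_i. *)
Definition d2 : 'M[S]_3 :=
  \matrix_(j, i) (cross (delta_mx 0 j) d3 0 i * mpow i).
Definition d1 : 'cV[S]_3 := \col_i (mpow (i + 1) * mpow (i + 2) * ypow i).
Definition d1_exponent (i : 'I_3) : 'X_{1..3} :=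
  (U_((i + 1 + 1)%R) *+ mexp (i + 1)%R + U_((i + 2 + 1)%R) *+ mexp (i + 2)%R
   + U_(i) *+ yexp i)%MM.

Lemma d1E i : d1 i 0 = 'X_[d1_exponent i].
Proof. by rewrite mxE /mpow /ypow !mpolyXn -!mpolyXD. Qed.

Lemma mpow_neq0 i : mpow i != 0.
Proof. by rewrite expf_eq0 -msupp_eq0 msuppX andbF. Qed.

Lemma ypow_neq0 i : ypow i != 0.
Proof. by rewrite expf_eq0 -msupp_eq0 msuppX andbF. Qed.

Lemma mulmx_d2 (v : 'rV[S]_3) i : (v *m d2) 0 i = cross v d3 0 i * mpow i.
Proof.
rewrite mxE sum3 !mxE; move: i; apply: ord3_ind; rewrite ?ord3_add /=; ring.
Qed.

Lemma d3_injective (u : 'rV[S]_1) : u *m d3 = 0 -> u = 0.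
Proof.
move/rowP/(_ 0); rewrite !mxE big_ord1 mxE => /eqP.
rewrite mulf_eq0 (negPf (ypow_neq0 _)) orbF => /eqP u0.
by apply/rowP => i; rewrite ord1 u0 mxE.
Qed.

Lemma exact_d3_d2 : exact_at d3 d2.
Proof.
move=> u; split=> [/rowP ud|[v ->]]; last first.
  apply/rowP => i; rewrite mulmx_d2 [v]mx11_scalar mul_scalar_mx crossZl crossvv.
  by rewrite scaler0 !mxE mul0r.
have /cross_eq0P uy : cross u d3 = 0.
  apply/rowP => i; have := ud i; rewrite mulmx_d2 [in RHS]mxE => /eqP.
  by rewrite mulf_eq0 (negPf (mpow_neq0 i)) orbF => /eqP ->; rewrite mxE.
have {}uy i j : u 0 i * ypow j = u 0 j * ypow i.
  by have := uy i j; rewrite !mxE.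
have [|t ut] := @divides_coprime_power k 3 0 1 (yexp 0) (yexp 1) (u 0 0) isT.
  by exists (u 0 1); rewrite mulrC uy mulrC.
exists t%:M; apply/rowP => j; rewrite mul_scalar_mx !mxE.
by apply: (mulIf (ypow_neq0 0)); rewrite -uy ut /ypow; ring.
Qed.

(** Exactness of the Koszul complex of y at its middle term. *)
Lemma koszul_exact (w : 'I_3 -> S) : \sum_i w i * ypow i = 0 ->
  exists v : 'rV[S]_3, forall i, w i = cross v d3 0 i.
Proof.
rewrite sum3 => w0.
have [||||al [be w2]] :=
  @powers_regular k 3 0 1 2 (yexp 0) (yexp 1) (yexp 2) (w 2) _ _ _ (- w 0) (- w 1) => //.
  apply/eqP; rewrite -subr_eq0 -w0 /ypow; apply/eqP; ring.
have [|ga w0E] := @divides_coprime_power k 3 1 0 (yexp 1) (yexp 0) (w 0 + al * ypow 2) isT.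
  exists (- (w 1 + be * ypow 2)); apply/eqP; rewrite -subr_eq0 -w0 w2 /ypow; apply/eqP; ring.
have w1E : w 1 + be * ypow 2 = - (ypow 0 * ga).
  apply: (mulIf (ypow_neq0 1)); apply/eqP; rewrite -subr_eq0 -w0 w2.
  have -> : w 0 = ypow 1 * ga - al * ypow 2 by rewrite -[ypow 1 * ga]w0E addrK.
  by rewrite /ypow; apply/eqP; ring.
(* Here w_0 = ga y_1 - al y_2, w_1 = - ga y_0 - be y_2, w_2 = al y_0 + be y_1. *)
exists (\row_i [:: be; - al; - ga]`_i).
apply: ord3_ind; rewrite !mxE !ord3_add /=.
- by rewrite -[w 0](addrK (al * ypow 2)) w0E /ypow; ring.
- by rewrite -[w 1](addrK (be * ypow 2)) w1E /ypow; ring.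
- by rewrite w2 /ypow; ring.
Qed.

(** Modulo m_i only the i-th term of the sum remains, and m_i is a power of
    x_(i+1), a variable that does not occur in the coefficient of u_i. *)
Lemma divides_mpow (u : 'I_3 -> S) i :
  \sum_l u l * (mpow (l + 1) * mpow (l + 2) * ypow l) = 0 -> divides (mpow i) (u i).
Proof.
move=> u0.
have : divides (mpow i) (mpow (i + 1) * (mpow (i + 2) * (ypow i * u i))).
  exists (- (u (i + 1) * mpow (i + 2) * ypow (i + 1)
           + u (i + 2) * mpow (i + 1) * ypow (i + 2))).
  apply/eqP; rewrite -subr_eq0 -u0 sum3; apply/eqP.
  by move: i; apply: ord3_ind; rewrite !ord3_add; ring.
have [ne1 ne2 ne3] : [/\ i + 1 != i + 1 + 1, i + 1 != i + 2 + 1 & i + 1 != i].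
  by move: i; apply: ord3_ind; rewrite !ord3_add.
by move=> /(divides_coprime_power ne1) /(divides_coprime_power ne2) /(divides_coprime_power ne3).
Qed.

Lemma exact_d2_d1 : exact_at d2 d1.
Proof.
move=> u; split=> [/rowP/(_ 0) ud|[v ->]]; last first.
  apply/rowP => i; rewrite ord1 mxE [RHS]mxE sum3 !mulmx_d2.
  by rewrite !mxE !ord3_add; ring.
have {}ud : \sum_l u 0 l * (mpow (l + 1) * mpow (l + 2) * ypow l) = 0.
  rewrite [RHS](_ : _ = (u *m d1) 0 0); last by rewrite ud mxE.
  by rewrite mxE; apply: eq_bigr => l _; rewrite [d1 l 0]mxE.
have /fin_all_exists [w wE] i : divides (mpow i) (u 0 i).
  exact: (@divides_mpow (fun l => u 0 l)).
have [|v vE] := koszul_exact (w := w).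
  have m0 : mpow 0 * mpow 1 * mpow 2 != 0 by rewrite !mulf_neq0 ?mpow_neq0.
  apply: (mulfI m0); rewrite mulr0 -[RHS]ud !sum3 !wE !ord3_add; ring.
by exists v; apply/rowP => i; rewrite mulmx_d2 -vE wE mulrC.
Qed.

Lemma homog_Xexp (i : 'I_3) c : homog_of_degree c%:Z ('X_i ^+ c : S).
Proof. by rewrite /= mpolyXn dhomogX /= mdegMn mdeg1 mul1n. Qed.

Lemma d3_graded : graded_map (fun=> s) b d3.
Proof. by move=> i j; rewrite mxE -yexpE; apply: homog_Xexp. Qed.

Lemma d2_graded : graded_map b a d2.
Proof.
move=> j i; rewrite mxE -[b j - a i](subrK (mexp i)%:Z).
apply: homogM; last exact: homog_Xexp.
have h l (x : bool) : (x -> b j - a i - (mexp i)%:Z = (yexp l)%:Z) ->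
    homog_of_degree (b j - a i - (mexp i)%:Z) (x%:R * ypow l).
  case: x => [->//|_]; first by rewrite mul1r; apply: homog_Xexp.
  by rewrite mul0r; case: (_ - _) => m //=; apply: dhomog0.
rewrite !mxE; apply: homogB; apply: h; rewrite eqxx /= yexpE mexpE sE !sum3.
  by move/eqP <-; move: i; apply: ord3_ind; rewrite !ord3_add; ring.
by move/eqP <-; move: i; apply: ord3_ind; rewrite !ord3_add; ring.
Qed.

Lemma d1_graded : graded_map a (fun=> 0) d1.
Proof.
move=> i j; rewrite ord1 d1E subr0.
have -> : a i = (mdeg (d1_exponent i))%:Z.
  rewrite !mdegD !mdegMn !mdeg1 !mul1n !PoszD !mexpE yexpE sE !sum3.
  by move: i; apply: ord3_ind; rewrite !ord3_add; ring.
by rewrite /= dhomogX.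
Qed.

Lemma ypow_const i : (ypow i)@_0%MM = 0.
Proof.
have : (0 < yexp i)%N by rewrite -ltz_nat yexpE subr_gt0.
by rewrite /ypow; case: (yexp i) => // c _; rewrite exprS mcoeff0M mcoeffX mnm1_eq0 mul0r.
Qed.

Lemma d1_minimal : minimal_map d1.
Proof. by move=> i j; rewrite mxE mcoeff0M ypow_const mulr0. Qed.

Lemma d2_minimal : minimal_map d2.
Proof.
by move=> i j; rewrite !mxE !(mcoeff0M, mcoeffB) !ypow_const !mulr0 subrr mul0r.
Qed.

Lemma d3_minimal : minimal_map d3.
Proof. by move=> i j; rewrite mxE ypow_const. Qed.

(** The i-th generator involves only x_i and x_(i+2), so P contains one of the
    two for each i, and therefore two of the three variables. *)
Lemma d1_height (P : prime_idealr S) :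
  (forall i, d1 i 0 \in P) -> prime_height_ge P 2.
Proof.
move=> dP; have XP i : ('X_i \in P) || ('X_(i + 2) \in P).
  have := dP i; rewrite mxE !prime_idealrM => /orP[/orP[]|] /prime_expr.
  - by rewrite -addrA ord3_add orbC => ->.
  - by rewrite -addrA ord3_add addr0 => ->.
  - by move=> ->.
have := XP 0; have := XP 1; have := XP 2; rewrite !ord3_add.
by do 3!case/orP=> ?; first [exact: (@two_variables_height k 3 P 0 1)
  | exact: (@two_variables_height k 3 P 0 2) | exact: (@two_variables_height k 3 P 1 2)].
Qed.

Lemma monomial_resolution : exists I : idealr S,
  [/\ homogeneous_ideal I, height_ge I 2 & has_minimal_resolution I a b s].
Proof.
have [i|I [homI IE]] := @monomial_ideal k 3 3 d1_exponent.
  apply/eqP => /mnmP/(_ i); rewrite !mnmDE mnm0E => /eqP.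
  rewrite addn_eq0 => /andP[_]; rewrite mulmnE mnm1E eqxx mul1n.
  by have := b_lt i; rewrite /yexp; lia.
exists I; split=> // [P IP|].
  apply: d1_height => i; apply: IP; apply/IE; exists (delta_mx 0 i).
  rewrite (bigD1 i) //= big1 ?mxE ?eqxx ?mul1r ?addr0 -?d1E ?mxE //.
  by move=> l /negPf li; rewrite mxE li andbF mul0r.
exists d1, d2, d3; split; split=> //.
- exact: d1_graded.
- exact: d2_graded.
- exact: d3_graded.
- exact: d1_minimal.
- exact: d2_minimal.
- exact: d3_minimal.
- move=> p; rewrite IE; split=> -[u uE]; exists u.
    apply/matrixP => i j; rewrite !ord1 mxE eqxx mulr1n uE mxE.
    by apply: eq_bigr => l _; rewrite d1E.
  have /matrixP/(_ 0 0) := uE; rewrite mxE eqxx mulr1n => ->; rewrite mxE.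
  by apply: eq_bigr => l _; rewrite d1E.
- exact: exact_d2_d1.
- exact: exact_d3_d2.
- exact: d3_injective.
Qed.

End Construction.

Lemma tnth3 (T : Type) (x0 x1 x2 : T) :
  ((tnth [tuple x0; x1; x2] 0 = x0) * (tnth [tuple x0; x1; x2] 1 = x1)
   * (tnth [tuple x0; x1; x2] 2 = x2))%type.
Proof. by []. Qed.

Theorem theorem3p5 (k : fieldType) (a1 a2 a3 b1 b2 b3 s : int)
    (ha12 : a1 <= a2) (ha23 : a2 <= a3) (hb12 : b2 <= b1) (hb23 : b3 <= b2) :
  essential_betti k [tuple a1; a2; a3] [tuple b1; b2; b3] s
  <->
  [/\ s = (b1 + b2 + b3) - (a1 + a2 + a3),
      a1 + a2 + a3 < b2 + b3
    & [/\ a1 + b1 <= a1 + a2 + a3,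
          a2 + b2 <= a1 + a2 + a3
        & a3 + b3 <= a1 + a2 + a3]].
Proof.
split=> [[[|r] [I [// _ _ htI]]]|[sE s_gt [le1 le2 le3]]].
  move=> [f [D [y [[fg Dg yg] [fm Dm ym] [If exf exD inj]]]]].
  have := degree_sum htI fg Dg yg If exf exD inj.
  have := b0_lt_s yg ym exf exD inj.
  have := b0_le_a12 htI fg Dg ym If exf exD.
  have := b1_le_a02 htI fg Dg Dm If exf.
  have := b2_le_a01 htI fg Dg fm If exf.
  rewrite !sum3 !tnth3 => L2 L1 L0 L sE.
  have {}L2 := L2 hb23 hb12; have {}L1 := L1 hb12 ha23; have {}L0 := L0 ha12 ha23.
  by split; [|lia|split; lia].
have [||i|I [hI htI resI]] :=
  @monomial_resolution k (tnth [tuple a1; a2; a3]) (tnth [tuple b1; b2; b3]) s.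
- by rewrite !sum3 !tnth3.
- by apply: ord3_ind; rewrite !tnth3; lia.
- by rewrite sum3; move: i; apply: ord3_ind; rewrite !tnth3; lia.
by exists 3, I.
Qed.
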